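(* There exists a coalgebra map $\pi:\mathcal{A}_2\to\varinjlim_k \mathcal{R}[k]$ induced by the maps $\pi_k:\mathcal{A}_2(k)\to\mathcal{R}[k]$ (that is, for each $k\ge 1$ the restriction of $\pi$ to $\mathcal{A}_2(k)$ is $\pi_k$ followed by the canonical map $\mathcal{R}[k]\to\varinjlim_k\mathcal{R}[k]$).
   Context: All vector spaces are over $\mathbb{F}_2$; binomial coefficients are taken mod 2. Free Hopf algebra: $\mathcal{F}_0$ is the free graded associative unital algebra on $\{Q^i\mid i\ge0\}$, $|Q^i|=i$, with coproduct the algebra map determined by $\psi(Q^i)=\sum_{t=0}^iQ^{i-t}\otimes Q^t$. For $I=(i_k,\dots,i_1)$ of non-negative integers put $Q^I=Q^{i_k}\cdots Q^{i_1}$, length $l(I)=k$, excess $e(I)=i_k-\sum_{t=1}^{k-1}i_t$ (the empty sequence has length $0$ and infinite excess). Steenrod side: $\mathcal{A}_2$ is the quotient Hopf algebra of $\mathcal{F}_0$ by the ideal generated by $Q^0-1$ and the Adem relations $Q^iQ^j-\sum_{k=0}^{[i/2]}\binom{j-k-1}{i-2k}Q^{i+j-k}Q^k$ for $i,j>0$, $i<2j$ (it is isomorphic to the mod 2 Steenrod algebra). A monomial $Q^{s_m}\cdots Q^{s_1}$ is admissible in $\mathcal{A}_2$ if $s_{t+1}\ge 2s_t$ for $1\le t<m$; the admissible monomials with all exponents positive, including the empty monomial $1$, form a basis of $\mathcal{A}_2$. $\mathcal{A}_2(k)$ is the subcoalgebra of $\mathcal{A}_2$ spanned by admissible monomials of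 length at most $k$; $\mathcal{A}_2(k)\subseteq\mathcal{A}_2(k+1)$ and $\mathcal{A}_2=\varinjlim\mathcal{A}_2(k)$. Dyer-Lashof side: $\mathcal{U}$ is the quotient of $\mathcal{F}_0$ by the two-sided ideal generated by monomials of negative excess; the Dyer-Lashof algebra $\mathcal{R}$ is the quotient Hopf algebra of $\mathcal{U}$ by the ideal generated by $Q^rQ^s-\sum_{t>0}\binom{t-s-1}{2t-r}Q^{r+s-t}Q^t$ for $r>2s$. $\mathcal{R}[k]$ is the subcoalgebra of $\mathcal{R}$ spanned by (the images of) monomials of length exactly $k$; a basis is given by the monomials $Q^{i_k}\cdots Q^{i_1}$ of non-negative excess with $i_{t+1}\le 2i_t$ for all $t$. The direct limit $\varinjlim_k\mathcal{R}[k]$ is taken along the coalgebra maps $\varphi_k:\mathcal{R}[k]\to\mathcal{R}[k+1]$, $\varphi_k(Q^I)=Q^IQ^0$. The map $\pi_k:\mathcal{A}_2(k)\to\mathcal{R}[k]$ is the linear map given on the basis of admissible monomials of $\mathcal{A}_2(k)$ by $\pi_k(Q^I)=Q^I\underbrace{Q^0\cdots Q^0}_{n}$ with $n=k-l(I)$ (so $\pi_k(Q^I)=Q^I$ if $l(I)=k$). *)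

(* Defs.v *)
From HB Require Import structures.
From mathcomp Require Import all_boot all_order all_algebra.
From mathcomp Require Import finmap boolp classical_sets.
From mathcomp.multinomials Require Import monalg.

Set Implicit Arguments.
Unset Strict Implicit.
Unset Printing Implicit Defensive.

Import Order.TTheory GRing.Theory Num.Theory.
Local Open Scope ring_scope.
Local Open Scope quotient_scope.

Notation F2 := ('F_2).

Inductive span (V : lmodType F2) (S : V -> Prop) : V -> Prop :=
| span_nil : span S 0
| span_cons (c : F2) (x y : V) : S x -> span S y -> span S (c *: x + y).

Definition spanp (V : lmodType F2) (S : V -> Prop) : {pred V} :=
  fun x => `[< span S x >].

Lemma spanP (V : lmodType F2) (S : V -> Prop) x :
  reflect (span S x) (x \in spanp S).
Proof. exact: asboolP. Qed.

Lemma spanp_submod (V : lmodType F2) (S : V -> Prop) : submod_closed (spanp S).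
Proof.
split; first exact/spanP/span_nil.
move=> c x y /spanP Sx /spanP Sy; apply/spanP.
elim: Sx => [|d u v Su _ IH]; first by rewrite scaler0 add0r.
by rewrite scalerDr scalerA -addrA; apply: span_cons.
Qed.

HB.instance Definition _ (V : lmodType F2) (S : V -> Prop) :=
  GRing.isSubmodClosed.Build F2 V (spanp S) (spanp_submod S).

Lemma mem_span (V : lmodType F2) (S : V -> Prop) x : S x -> x \in spanp S.
Proof.
by move=> Sx; apply/spanP; rewrite -[x]addr0 -[x]scale1r; apply/span_cons/span_nil.
Qed.

Definition subspace (V : lmodType F2) (S : V -> Prop) : Type :=
  {x : V | x \in spanp S}.

HB.instance Definition _ (V : lmodType F2) (S : V -> Prop) :=
  SubChoice.copy (subspace S) {x : V | x \in spanp S}.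
HB.instance Definition _ (V : lmodType F2) (S : V -> Prop) :=
  [SubChoice_isSubLmodule of subspace S by <:].

Definition quotient (V : lmodType F2) (S : V -> Prop) : Type :=
  Quotient.quot (spanp S : zmodClosed V).

HB.instance Definition _ (V : lmodType F2) (S : V -> Prop) :=
  GRing.Zmodule.on (quotient S).
HB.instance Definition _ (V : lmodType F2) (S : V -> Prop) :=
  Quotient.on (quotient S).

Definition proj (V : lmodType F2) (S : V -> Prop) (x : V) : quotient S :=
  \pi_(quotient S) x.

Section QuotientTheory.
Variables (V : lmodType F2) (S : V -> Prop).
Implicit Types (x y : V) (a b : quotient S).

Lemma projP x y : proj S x = proj S y <-> x - y \in spanp S.
Proof.
rewrite (Quotient.idealrBE (spanp S : zmodClosed V)); split=> [/eqP //|/eqP //].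
Qed.

Lemma proj_repr a : proj S (repr a) = a.
Proof. exact: reprK. Qed.

Lemma projD x y : proj S (x + y) = proj S x + proj S y.
Proof. exact: (@raddfD _ _ \pi_(quotient S)). Qed.

Definition quotient_scale (c : F2) a : quotient S := proj S (c *: repr a).

Lemma proj_scale c x : proj S (c *: x) = quotient_scale c (proj S x).
Proof.
by apply/projP; rewrite -scalerBr rpredZ //; apply/projP; rewrite proj_repr.
Qed.

Fact quotient_scaleA c d a :
  quotient_scale c (quotient_scale d a) = quotient_scale (c * d) a.
Proof. by rewrite -[a]proj_repr -!proj_scale scalerA. Qed.

Fact quotient_scale1 : left_id 1 quotient_scale.
Proof. by move=> a; rewrite -[a]proj_repr -proj_scale scale1r. Qed.

Fact quotient_scaleDr : right_distributive quotient_scale +%R.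
Proof.
by move=> c a b; rewrite -[a]proj_repr -[b]proj_repr -projD -!proj_scale scalerDr projD.
Qed.

Fact quotient_scaleDl a : {morph quotient_scale^~ a : c d / c + d}.
Proof. by move=> c d; rewrite -[a]proj_repr -!proj_scale scalerDl projD. Qed.

HB.instance Definition _ := GRing.Zmodule_isLmodule.Build F2 (quotient S)
  quotient_scaleA quotient_scale1 quotient_scaleDr quotient_scaleDl.

Fact proj_linear : linear (proj S).
Proof. by move=> c x y; rewrite projD proj_scale. Qed.

HB.instance Definition _ :=
  GRing.isLinear.Build F2 V (quotient S) _ (proj S) proj_linear.

(* Evaluation on a representative; meaningful for linear [f] vanishing on [S]. *)
Definition induced (W : lmodType F2) (f : V -> W) (a : quotient S) : W :=
  f (repr a).

Lemma inducedE (W : lmodType F2) (f : {linear V -> W}) :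
  (forall s, S s -> f s = 0) -> forall x, induced f (proj S x) = f x.
Proof.
move=> fS x; apply/eqP; rewrite -subr_eq0 -linearB /=; apply/eqP.
have /projP/spanP : proj S (repr (proj S x)) = proj S x by rewrite proj_repr.
elim=> [|c y z /fS fy _ fz]; first by rewrite linear0.
by rewrite linearP fy fz scaler0 addr0.
Qed.
End QuotientTheory.

Lemma F2_scale (V : lmodType F2) (c : F2) (x : V) : c *: x = x *+ c.
Proof. by rewrite -[in LHS](natr_Zp c) scaler_nat. Qed.

Definition two_sided (A : lalgType F2) (S : A -> Prop) : A -> Prop :=
  fun x => exists a s b, S s /\ x = a * s * b.

Lemma two_sidedMl (A : lalgType F2) (S : A -> Prop) a x :
  x \in spanp (two_sided S) -> a * x \in spanp (two_sided S).
Proof.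
move=> /spanP; elim=> [|c _ y [u [s [v [Ss ->]]]] _ IH]; first by rewrite mulr0 rpred0.
rewrite mulrDr rpredD // !F2_scale mulrnAr rpredMn // mem_span //.
by exists (a * u), s, v; rewrite !mulrA.
Qed.

Lemma two_sidedMr (A : lalgType F2) (S : A -> Prop) a x :
  x \in spanp (two_sided S) -> x * a \in spanp (two_sided S).
Proof.
move=> /spanP; elim=> [|c _ y [u [s [v [Ss ->]]]] _ IH]; first by rewrite mul0r rpred0.
rewrite mulrDl rpredD // !F2_scale mulrnAl rpredMn // mem_span //.
by exists u, s, (v * a); rewrite !mulrA.
Qed.

Lemma spanp_mulr (A : lalgType F2) (S T : A -> Prop) (z : A) :
  (forall x, S x -> T (x * z)) -> forall x, x \in spanp S -> x * z \in spanp T.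
Proof.
move=> ST x /spanP; elim=> [|c u y Su _ IH]; first by rewrite mul0r rpred0.
rewrite mulrDl -scalerAl rpredD // rpredZ //; exact/mem_span/ST.
Qed.

(* The library's rings satisfy [1 != 0], so the quotient algebra is only formed *)
(* for a proper ideal.                                                         *)
Definition proper (A : lalgType F2) (S : A -> Prop) : Prop :=
  1 \notin spanp (two_sided S).

Definition alg_quotient (A : lalgType F2) (S : A -> Prop) (pS : proper S) : Type :=
  quotient (two_sided S).

HB.instance Definition _ (A : lalgType F2) (S : A -> Prop) (pS : proper S) :=
  GRing.Lmodule.on (alg_quotient pS).
HB.instance Definition _ (A : lalgType F2) (S : A -> Prop) (pS : proper S) :=
  Quotient.on (alg_quotient pS).

Definition aproj (A : lalgType F2) (S : A -> Prop) (pS : proper S) (x : A) :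
  alg_quotient pS := proj (two_sided S) x.

HB.instance Definition _ (A : lalgType F2) (S : A -> Prop) (pS : proper S) :=
  GRing.isLinear.Build F2 A (alg_quotient pS) _ (aproj pS)
    (@proj_linear A (two_sided S)).

Section AlgQuotient.
Variables (A : lalgType F2) (S : A -> Prop) (pS : proper S).
Implicit Types (x y : A) (a b : alg_quotient pS).

Lemma aproj_repr a : aproj pS (repr a) = a.
Proof. exact: proj_repr. Qed.

Definition quotient_mul a b : alg_quotient pS := aproj pS (repr a * repr b).

Lemma aproj_mul x y : aproj pS (x * y) = quotient_mul (aproj pS x) (aproj pS y).
Proof.
set x' := repr (aproj pS x); set y' := repr (aproj pS y).
have xx' : x - x' \in spanp (two_sided S) by apply/projP; rewrite proj_repr.
have yy' : y - y' \in spanp (two_sided S) by apply/projP; rewrite proj_repr.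
apply/projP; rewrite -/x' -/y'.
have -> : x * y - x' * y' = x * (y - y') + (x - x') * y'.
  by rewrite mulrBr mulrBl addrA subrK.
by apply: rpredD; [exact: two_sidedMl | exact: two_sidedMr].
Qed.

Fact quotient_mulA : associative quotient_mul.
Proof.
move=> a b c; rewrite -[a]aproj_repr -[b]aproj_repr -[c]aproj_repr.
by rewrite -!aproj_mul mulrA.
Qed.

Fact quotient_mul1 : left_id (aproj pS 1) quotient_mul.
Proof. by move=> a; rewrite -[a]aproj_repr -aproj_mul mul1r. Qed.

Fact quotient_mulr1 : right_id (aproj pS 1) quotient_mul.
Proof. by move=> a; rewrite -[a]aproj_repr -aproj_mul mulr1. Qed.

Fact quotient_mulDl : left_distributive quotient_mul +%R.
Proof.
move=> a b c; rewrite -[a]aproj_repr -[b]aproj_repr -[c]aproj_repr.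
by rewrite -linearD -!aproj_mul mulrDl linearD.
Qed.

Fact quotient_mulDr : right_distributive quotient_mul +%R.
Proof.
move=> a b c; rewrite -[a]aproj_repr -[b]aproj_repr -[c]aproj_repr.
by rewrite -linearD -!aproj_mul mulrDr linearD.
Qed.

Fact quotient_1neq0 : aproj pS 1 != 0.
Proof.
apply/negP => /eqP eq10; case/negP: (pS); rewrite -[1]subr0; apply/projP.
by rewrite [RHS](linear0 (aproj pS)).
Qed.

HB.instance Definition _ := GRing.Zmodule_isNzRing.Build (alg_quotient pS)
  quotient_mulA quotient_mul1 quotient_mulr1 quotient_mulDl quotient_mulDr
  quotient_1neq0.

Fact quotient_scaleAl (c : F2) a b : c *: (a * b) = (c *: a) * b.
Proof. by rewrite !F2_scale mulrnAl. Qed.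

HB.instance Definition _ :=
  GRing.Lmodule_isLalgebra.Build F2 (alg_quotient pS) quotient_scaleAl.

Lemma aprojM x y : aproj pS (x * y) = aproj pS x * aproj pS y.
Proof. exact: aproj_mul. Qed.
End AlgQuotient.

(* An algebra map to [F2] vanishing on the relations witnesses properness. *)
Definition augmentation (A : lalgType F2) (e : A -> F2) : Prop :=
  [/\ forall x y, e (x + y) = e x + e y, forall x y, e (x * y) = e x * e y & e 1 = 1].

Section Augmentation.
Variables (A : lalgType F2) (S : A -> Prop) (e : A -> F2).
Hypotheses (eA : augmentation e) (eS : forall s, S s -> e s = 0).

Lemma augmentation_ideal x : x \in spanp (two_sided S) -> e x = 0.
Proof.
case: eA => eD eM _; have e0 : e 0 = 0 by apply: (addrI (e 0)); rewrite -eD !addr0.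
have eMn y n : e y = 0 -> e (y *+ n) = 0.
  by move=> ey; elim: n => [|n IH]; rewrite ?mulr0n // mulrS eD ey IH addr0.
move=> /spanP; elim=> // c _ y [u [s [v [Ss ->]]]] _ ey.
by rewrite eD ey addr0 F2_scale eMn // !eM (eS Ss) mulr0 mul0r.
Qed.

Lemma augmentation_proper : proper S.
Proof.
by apply/negP => /augmentation_ideal; case: eA => _ _ -> /eqP; rewrite oner_eq0.
Qed.

Variable pS : proper S.

Lemma augmentation_induced :
  augmentation (fun a : alg_quotient pS => e (repr a)) /\
  forall x, e (repr (aproj pS x)) = e x.
Proof.
case: (eA) => eD eM e1.
have eP x : e (repr (aproj pS x)) = e x.
  have -> : e (repr (aproj pS x)) = e (repr (aproj pS x) - x) + e x.
    by rewrite -eD subrK.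
  by rewrite augmentation_ideal ?add0r //; apply/projP; rewrite proj_repr.
split=> //; split=> [a b|a b|]; last by rewrite eP.
- by rewrite -{1}[a]aproj_repr -{1}[b]aproj_repr -linearD eP eD.
- by rewrite -{1}[a]aproj_repr -{1}[b]aproj_repr -aprojM eP eM.
Qed.
End Augmentation.

(* [{malg F2[K]}] is used for its vector space structure: it is free on [K]. *)
Definition extend (K : choiceType) (W : lmodType F2) (h : K -> W)
  (x : {malg F2[K]}) : W := \sum_(k <- msupp x) x@_k *: h k.

Section Extend.
Variables (K : choiceType) (W : lmodType F2) (h : K -> W).

Lemma extendEw (d : {fset K}) x : (msupp x `<=` d)%fset ->
  extend h x = \sum_(k <- d) x@_k *: h k.
Proof.
move=> le; rewrite /extend (big_fset_incl _ le) => //= k _ /mcoeff_outdom ->.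
by rewrite scale0r.
Qed.

Fact extend_linear : linear (extend h).
Proof.
move=> c x y; pose d := (msupp x `|` msupp y `|` msupp (c *: x + y))%fset.
have dx : (msupp x `<=` d)%fset by rewrite /d -fsetUA fsubsetUl.
have dy : (msupp y `<=` d)%fset by rewrite /d fsetUAC fsubsetUr.
have dxy : (msupp (c *: x + y) `<=` d)%fset by rewrite /d fsubsetUr.
rewrite (extendEw dx) (extendEw dy) (extendEw dxy).
rewrite scaler_sumr -big_split; apply: eq_bigr => k _ /=.
by rewrite mcoeffD mcoeffZ scalerDl scalerA.
Qed.

HB.instance Definition _ :=
  GRing.isLinear.Build F2 {malg F2[K]} W _ (extend h) extend_linear.

Lemma extendU k : extend h << k >> = h k.
Proof. by rewrite (extendEw msuppU_le) big_seq_fset1 mcoeffUU scale1r. Qed.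
End Extend.

Inductive bilinear_rel (V W : lmodType F2) : {malg F2[(V * W)%type]} -> Prop :=
| bilinear_Dl v v' w :
    bilinear_rel (<< (v + v', w) >> - << (v, w) >> - << (v', w) >>)
| bilinear_Dr v w w' :
    bilinear_rel (<< (v, w + w') >> - << (v, w) >> - << (v, w') >>)
| bilinear_Zl c v w : bilinear_rel (<< (c *: v, w) >> - c *: << (v, w) >>)
| bilinear_Zr c v w : bilinear_rel (<< (v, c *: w) >> - c *: << (v, w) >>).

Definition tensor (V W : lmodType F2) : lmodType F2 :=
  quotient (@bilinear_rel V W).

Definition tens (V W : lmodType F2) (v : V) (w : W) : tensor V W :=
  proj (@bilinear_rel V W) << (v, w) >>.

(* [f (x) g]; only used for linear [f] and [g]. *)
Definition tmap (V V' W W' : lmodType F2) (f : V -> V') (g : W -> W') :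
  tensor V W -> tensor V' W' :=
  induced (extend (fun p : V * W => tens (f p.1) (g p.2))).

Section TensorTheory.
Variables (V W : lmodType F2).

Lemma tensDl v v' w : tens (v + v') w = tens v w + tens v' w :> tensor V W.
Proof.
rewrite /tens -linearD; apply/projP/mem_span; rewrite opprD addrA.
exact: bilinear_Dl.
Qed.

Lemma tensDr v w w' : tens v (w + w') = tens v w + tens v w' :> tensor V W.
Proof.
rewrite /tens -linearD; apply/projP/mem_span; rewrite opprD addrA.
exact: bilinear_Dr.
Qed.

Lemma tensZl c v w : tens (c *: v) w = c *: tens v w :> tensor V W.
Proof. by rewrite /tens -linearZ; apply/projP/mem_span; apply: bilinear_Zl. Qed.

Lemma tensZr c v w : tens v (c *: w) = c *: tens v w :> tensor V W.
Proof. by rewrite /tens -linearZ; apply/projP/mem_span; apply: bilinear_Zr. Qed.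

End TensorTheory.

Section TensorMap.
Variables (V W V' W' : lmodType F2) (f : {linear V -> V'}) (g : {linear W -> W'}).

Lemma tmap_proj x : tmap f g (proj (@bilinear_rel V W) x) =
  extend (fun p : V * W => tens (f p.1) (g p.2)) x.
Proof.
rewrite /tmap; apply: inducedE => _ [v v' w|v w w'|c v w|c v w].
- by rewrite !linearB /= !extendU /= linearD tensDl -addrA -opprD subrr.
- by rewrite !linearB /= !extendU /= linearD tensDr -addrA -opprD subrr.
- by rewrite linearB linearZ /= !extendU /= linearZ tensZl subrr.
- by rewrite linearB linearZ /= !extendU /= linearZ tensZr subrr.
Qed.

Lemma tmapE v w : tmap f g (tens v w) = tens (f v) (g w).
Proof. by rewrite tmap_proj extendU. Qed.

Lemma tmap_linear : linear (tmap f g).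
Proof.
move=> c a b; rewrite -[a]proj_repr -[b]proj_repr -linearP !tmap_proj.
exact: linearP.
Qed.
End TensorMap.

(* The product [(a (x) b) (c (x) d) = ac (x) bd] of [A (x) A]: left            *)
(* multiplication by [a (x) b] is the tensor product of the left               *)
(* multiplications by [a] and by [b].                                          *)
Definition tensor_mul (A : lalgType F2) (y z : tensor A A) : tensor A A :=
  induced (extend (fun p : A * A => tmap ( *%R p.1) ( *%R p.2) z)) y.

Section DirectLimit.
Variables (V : nat -> lmodType F2) (f : forall k, V k -> V k.+1).

Definition stage (k : nat) (x : V k) : {malg F2[{k : nat & V k}]} :=
  << Tagged (fun k => V k : Type) x >>.

Inductive limit_rel : {malg F2[{k : nat & V k}]} -> Prop :=
| limit_D k (x y : V k) : limit_rel (stage (x + y) - stage x - stage y)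
| limit_Z k c (x : V k) : limit_rel (stage (c *: x) - c *: stage x)
| limit_step k (x : V k) : limit_rel (stage (f x) - stage x).

Definition direct_limit : lmodType F2 := quotient limit_rel.

Definition to_limit (k : nat) (x : V k) : direct_limit :=
  proj limit_rel (stage x).
End DirectLimit.

Section DirectLimitTheory.
Variables (V : nat -> lmodType F2) (f : forall k, V k -> V k.+1).

Lemma to_limit_linear k : linear (@to_limit V f k).
Proof.
move=> c x y; rewrite /to_limit -linearP.
have -> : proj (limit_rel f) (stage (c *: x + y)) =
    proj (limit_rel f) (stage (c *: x)) + proj (limit_rel f) (stage y).
  by rewrite -linearD; apply/projP/mem_span; rewrite opprD addrA; apply: limit_D.
rewrite linearP; congr (_ + _).
by rewrite -linearZ; apply/projP/mem_span; apply: limit_Z.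
Qed.

Lemma to_limit_step k (x : V k) : to_limit f (f x) = to_limit f x.
Proof. by apply/projP/mem_span; apply: limit_step. Qed.
End DirectLimitTheory.

(* The coproduct of a quotient Hopf algebra, [q] being the projection: it maps *)
(* [q x] to [(q (x) q) (d x)], which depends only on [q x] as the ideal         *)
(* generated by [S] is a Hopf ideal.                                           *)
Definition quotient_comul (A : lalgType F2) (S : A -> Prop) (pS : proper S)
    (d : A -> tensor A A) (a : alg_quotient pS) :
    tensor (alg_quotient pS) (alg_quotient pS) :=
  tmap (aproj pS) (aproj pS) (d (repr a)).

Definition quotient_counit (A : lalgType F2) (S : A -> Prop) (pS : proper S)
  (e : A -> F2) (a : alg_quotient pS) : F2 := e (repr a).

(* The coproduct of a direct limit of coalgebras along coalgebra maps: it maps *)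
(* the class of [x : V k] to the class of the coproduct of [x].                *)
Definition limit_comul (V : nat -> lmodType F2) (f : forall k, V k -> V k.+1)
    (d : forall k, V k -> tensor (V k) (V k)) :
  direct_limit f -> tensor (direct_limit f) (direct_limit f) :=
  induced (extend (fun p : {k : nat & V k} =>
    tmap (@to_limit V f (tag p)) (@to_limit V f (tag p)) (d (tag p) (tagged p)))).

Definition limit_counit (V : nat -> lmodType F2) (f : forall k, V k -> V k.+1)
    (e : forall k, V k -> F2) : direct_limit f -> F2 :=
  fun a => extend (fun p : {k : nat & V k} => (e (tag p) (tagged p) : F2^o)) (repr a).

Definition coalgebra_map (C D : lmodType F2)
    (dC : C -> tensor C C) (eC : C -> F2) (dD : D -> tensor D D) (eD : D -> F2)
    (f : {linear C -> D}) : Prop :=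
  (forall x, dD (f x) = tmap f f (dC x)) /\ (forall x, eD (f x) = eC x).

Definition F0 : lalgType F2 := {malg F2[{fmonom nat}]}.

(* The sequence (i_k, ..., i_1) is the list [:: i_k; ...; i_1].                 *)
Definition Q (I : seq nat) : F0 := << FMonom I >>.

Lemma Q_nil : Q [::] = 1.
Proof. by congr << _ >>; apply: val_inj; rewrite /= fm1. Qed.

Lemma Q_cat I J : Q (I ++ J) = Q I * Q J.
Proof.
rewrite /Q [RHS]malgM_def fgmulUU mulr1; congr (<< _ >>).
by apply: val_inj; rewrite /= fmM.
Qed.

Definition comul_generator (i : nat) : tensor F0 F0 :=
  \sum_(0 <= t < i.+1) tens (Q [:: (i - t)%N]) (Q [:: t]).

Definition comulF0 : F0 -> tensor F0 F0 :=
  extend (fun I : {fmonom nat} =>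
    foldr (fun i z => tensor_mul (comul_generator i) z) (tens 1 1) (I : seq nat)).

(* The counit is the algebra map with Q^0 |-> 1 and Q^i |-> 0 for i > 0.        *)
Definition counitF0 : F0 -> F2 :=
  extend (fun I : {fmonom nat} => ((all (pred1 0%N) I)%:R : F2^o)).

Lemma F0_basis (x : F0) : x = \sum_(I <- msupp x) x@_I *: Q I.
Proof.
rewrite {1}[x]monalgE; apply: eq_bigr => -[I] _.
apply/malgP => J; rewrite [RHS]mcoeffZ [LHS]mcoeffU.
by rewrite [X in _ = _ * X]mcoeffU mulrnAr mulr1.
Qed.

Lemma F0_ind (P : F0 -> Prop) :
  P 0 -> (forall c I x, P x -> P (c *: Q I + x)) -> forall x, P x.
Proof.
move=> P0 PS x; rewrite (F0_basis x).
elim: (msupp x : seq _) => [|[I] r IH]; first by rewrite big_nil.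
by rewrite big_cons; apply: PS.
Qed.

Lemma counitF0_Q I : counitF0 (Q I) = (all (pred1 0%N) I)%:R.
Proof. by rewrite /counitF0 extendU. Qed.

Lemma F0_augmentation (e : F0 -> F2) :
  (forall c x y, e (c *: x + y) = c * e x + e y) ->
  (forall I J, e (Q (I ++ J)) = e (Q I) * e (Q J)) -> e (Q [::]) = 1 ->
  augmentation e.
Proof.
move=> eL eM e1.
have eD x y : e (x + y) = e x + e y by rewrite -[x]scale1r eL mul1r scale1r.
have e0 : e 0 = 0 by apply: (addrI (e 0)); rewrite -eD !addr0.
split=> [//|x y|]; last by rewrite -Q_nil.
elim/F0_ind: x => [|c I x IHx]; first by rewrite mul0r e0 mul0r.
have -> : (c *: Q I + x) * y = c *: (Q I * y) + x * y by rewrite mulrDl scalerAl.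
rewrite (eL c (Q I * y)) (eL c (Q I)) [RHS]mulrDl; congr (_ + _) => //.
rewrite -[RHS]mulrA; congr (_ * _); move: {x IHx} y.
elim/F0_ind => [|d J y IHy]; first by rewrite mulr0 e0 mulr0.
have -> : Q I * (d *: Q J + y) = d *: Q (I ++ J) + Q I * y.
  by rewrite mulrDr Q_cat !F2_scale mulrnAr.
by rewrite (eL d (Q J)) eL eM IHy mulrDr mulrCA.
Qed.

Lemma counitF0_augmentation : augmentation counitF0.
Proof.
apply: F0_augmentation => [c x y|I J|]; first by rewrite /counitF0 linearP.
- by rewrite !counitF0_Q all_cat -mulnb natrM.
- by rewrite counitF0_Q.
Qed.

(* All the subtractions below are between non-negative integers with a         *)
(* non-negative difference, since [2 * k <= i < 2 * j].                        *)
Definition adem (i j : nat) : F0 :=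
  Q [:: i; j] - \sum_(0 <= k < (i %/ 2).+1)
    ('C(j - k - 1, i - 2 * k))%:R *: Q [:: (i + j - k)%N; k].

Inductive steenrod_rel : F0 -> Prop :=
| steenrod_Q0 : steenrod_rel (Q [:: 0%N] - 1)
| steenrod_adem i j :
    (0 < i)%N -> (0 < j)%N -> (i < 2 * j)%N -> steenrod_rel (adem i j).

Lemma counitF0_sumr (r : seq nat) (P : pred nat) (c : nat -> F2) (I : nat -> seq nat) :
  (forall k, (k \in r) && P k -> ~~ all (pred1 0%N) (I k)) ->
  counitF0 (\sum_(k <- r | P k) c k *: Q (I k)) = 0.
Proof.
move=> hI; rewrite /counitF0 linear_sum big_seq_cond big1 // => k /hI.
by rewrite linearZ /= extendU => /negbTE ->; rewrite scaler0.
Qed.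

Lemma counitF0_steenrod x : steenrod_rel x -> counitF0 x = 0.
Proof.
case=> [|i j i_gt0 j_gt0 ij].
  by rewrite -Q_nil /counitF0 linearB /= !extendU subrr.
rewrite /adem /counitF0 linearB /= -/(counitF0 _) -/(counitF0 _) counitF0_Q /=.
rewrite counitF0_sumr ?subr0; first by rewrite (gtn_eqF i_gt0).
move=> k; rewrite mem_index_iota andbT => /= ki.
rewrite andbT negb_and -lt0n subn_gt0 -!lt0n.
by case: k {ki} => [|k]; rewrite ?addn_gt0 ?i_gt0 ?orbT.
Qed.

Lemma steenrod_proper : proper steenrod_rel.
Proof. exact: augmentation_proper counitF0_augmentation counitF0_steenrod. Qed.

Definition A2 : lalgType F2 := alg_quotient steenrod_proper.

Definition projA : {linear F0 -> A2} := aproj steenrod_proper.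

Definition comulA : A2 -> tensor A2 A2 := @quotient_comul F0 _ steenrod_proper comulF0.
Definition counitA : A2 -> F2 := @quotient_counit F0 _ steenrod_proper counitF0.

Definition admissible (I : seq nat) : bool :=
  all (leq 1) I && sorted (fun x y => 2 * y <= x)%N I.

Definition A2_le (k : nat) : lmodType F2 :=
  subspace (fun x : A2 =>
    exists I, [/\ admissible I, (size I <= k)%N & x = projA (Q I)]).

Definition inclA (k : nat) (a : A2_le k) : A2 := sval a.

(* The expansion of [a] in the basis of admissible monomials: an element of    *)
(* the free algebra supported on these monomials and mapped to [a].  It exists *)
(* by definition of [A2_le k], and is unique since the admissible monomials    *)
(* are linearly independent in [A2].                                           *)
Definition admissible_expansion (k : nat) (a : A2_le k) : F0 :=
  xget 0 [set x : F0 | projA x = inclA a /\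
    forall I : {fmonom nat}, I \in msupp x -> admissible I && (size I <= k)%N]%classic.

Lemma admissible_expansionP (k : nat) (a : A2_le k) :
  projA (admissible_expansion a) = inclA a /\
  forall I : {fmonom nat}, I \in msupp (admissible_expansion a : {malg F2[{fmonom nat}]}) ->
    admissible I && (size I <= k)%N.
Proof.
apply: (@xgetPex F0 0 [set x : F0 | projA x = inclA a /\
  forall I : {fmonom nat}, I \in msupp x -> admissible I && (size I <= k)%N]%classic).
case: a => a /= /spanP; elim=> [|c _ y [I [aI sI ->]] _ [x [xy xI]]].
  by exists 0; split=> [|I]; [exact: linear0 | rewrite msupp0].
exists (c *: Q I + x); split=> [|J]; first by rewrite /inclA /= -xy; exact: linearP.
move=> /(fsubsetP (msuppD_le _ _)); rewrite in_fsetU => /orP[|/xI//].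
move=> /(fsubsetP (msuppZ_le _ _)); rewrite msuppU1 in_fset1 => /eqP ->.
by rewrite aI sI.
Qed.

Definition excess (i : nat) (J : seq nat) : int := i%:Z - (sumn J)%:Z.

(* The empty sequence has infinite excess.                                     *)
Definition negative_excess (I : seq nat) : bool :=
  if I is i :: J then excess i J < 0 else false.

Definition excess_rel (x : F0) : Prop := exists I, negative_excess I /\ x = Q I.

Lemma counitF0_excess x : excess_rel x -> counitF0 x = 0.
Proof.
case=> -[|i J] [] //; rewrite /negative_excess /excess subr_lt0 ltz_nat => iJ ->.
rewrite counitF0_Q; case: allP => // z.
have z0 k : k \in i :: J -> k = 0%N by move/z/eqP.
suff JE : sumn J = 0%N by rewrite JE in iJ.
have : forall k, k \in J -> k = 0%N by move=> k kJ; apply: z0; rewrite inE kJ orbT.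
elim: J {iJ z z0} => //= j J IH z; rewrite (z j (mem_head j J)) IH // => k kJ.
by apply: z; rewrite inE kJ orbT.
Qed.

Lemma excess_proper : proper excess_rel.
Proof. exact: augmentation_proper counitF0_augmentation counitF0_excess. Qed.

Definition U : lalgType F2 := alg_quotient excess_proper.

Definition projU : {linear F0 -> U} := aproj excess_proper.

Definition comulU : U -> tensor U U := @quotient_comul F0 _ excess_proper comulF0.
Definition counitU : U -> F2 := @quotient_counit F0 _ excess_proper counitF0.

(* The binomial coefficient vanishes unless [r <= 2 * t] and [t <= r - s - 1],  *)
(* hence the range of the sum.                                                 *)
Definition dyer_lashof (r s : nat) : U :=
  projU (Q [:: r; s]) - \sum_(1 <= t < (r + s).+1 | (r <= 2 * t)%N)
    ('C(t - s - 1, 2 * t - r))%:R *: projU (Q [:: (r + s - t)%N; t]).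

Definition dyer_lashof_rel (x : U) : Prop :=
  exists r s, (2 * s < r)%N /\ x = dyer_lashof r s.

Lemma linear_subr_sum (V W : lmodType F2) (f : {linear V -> W}) (x : V)
    (r : seq nat) (P : pred nat) (c : nat -> F2) (g : nat -> V) :
  f (x - \sum_(k <- r | P k) c k *: g k) = f x - \sum_(k <- r | P k) c k *: f (g k).
Proof.
by rewrite linearB linear_sum; congr (_ - _); apply: eq_bigr => k _; exact: linearZ.
Qed.

Lemma counitU_augmentation : augmentation counitU.
Proof.
exact: (augmentation_induced counitF0_augmentation counitF0_excess excess_proper).1.
Qed.

Lemma counitU_projU x : counitU (projU x) = counitF0 x.
Proof.
exact: (augmentation_induced counitF0_augmentation counitF0_excess excess_proper).2.
Qed.

Lemma counitU_dyer_lashof x : dyer_lashof_rel x -> counitU x = 0.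
Proof.
case=> r [s [rs ->]].
have -> : dyer_lashof r s = projU (Q [:: r; s] -
    \sum_(1 <= t < (r + s).+1 | (r <= 2 * t)%N)
      ('C(t - s - 1, 2 * t - r))%:R *: Q [:: (r + s - t)%N; t]).
  by rewrite linear_subr_sum.
rewrite counitU_projU /counitF0 linearB /= -/(counitF0 _) -/(counitF0 _) counitF0_Q /=.
rewrite counitF0_sumr ?subr0.
  by rewrite (gtn_eqF (leq_ltn_trans (leq0n _) rs)).
by move=> t; rewrite mem_index_iota => /andP[/andP[t_gt0 _] _] /=;
  rewrite andbT (gtn_eqF t_gt0) andbF.
Qed.

Lemma dyer_lashof_proper : proper dyer_lashof_rel.
Proof. exact: augmentation_proper counitU_augmentation counitU_dyer_lashof. Qed.

Definition R : lalgType F2 := alg_quotient dyer_lashof_proper.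

Definition projUR : {linear U -> R} := aproj dyer_lashof_proper.
Definition projR : {linear F0 -> R} := projUR \o projU.

Definition comulR : R -> tensor R R := @quotient_comul U _ dyer_lashof_proper comulU.
Definition counitR : R -> F2 := @quotient_counit U _ dyer_lashof_proper counitU.

Lemma projUM x y : projU (x * y) = projU x * projU y.
Proof. exact: (aprojM excess_proper). Qed.

Lemma projURM x y : projUR (x * y) = projUR x * projUR y.
Proof. exact: (aprojM dyer_lashof_proper). Qed.

Lemma projRE x : projR x = projUR (projU x).
Proof. by []. Qed.

Lemma projRM x y : projR (x * y) = projR x * projR y.
Proof. by rewrite !projRE projUM projURM. Qed.

Definition Rlen_gen (k : nat) (x : R) : Prop :=
  exists I, size I = k /\ x = projR (Q I).

Definition Rlen (k : nat) : lmodType F2 := subspace (Rlen_gen k).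

Definition inclR (k : nat) (x : Rlen k) : R := sval x.

Lemma Rlen_mono_subproof (k : nat) (I : k.-tuple nat) :
  projR (Q I) \in spanp (Rlen_gen k).
Proof. by apply: mem_span; exists I; rewrite size_tuple. Qed.

(* The class of [Q I] in R[k] if [I] has length [k], and 0 otherwise.          *)
Definition Rlen_mono (k : nat) (I : seq nat) : Rlen k :=
  if insub I : option (k.-tuple nat) is Some J
  then exist _ (projR (Q J)) (@Rlen_mono_subproof k J) else 0.

(* The relations defining R are homogeneous for the length of monomials, so    *)
(* that R is the direct sum of the R[k]; this is the projection onto R[k].      *)
Definition part (k : nat) (x : R) : Rlen k :=
  extend (fun I : {fmonom nat} => Rlen_mono k I) (repr (repr x : U) : F0).

(* R[k] is a subcoalgebra of R: composing with the projection corestricts the  *)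
(* coproduct to R[k] (x) R[k].                                                 *)
Definition comulRlen (k : nat) (x : Rlen k) : tensor (Rlen k) (Rlen k) :=
  tmap (@part k) (@part k) (comulR (inclR x)).

Definition counitRlen (k : nat) (x : Rlen k) : F2 := counitR (inclR x).

Lemma phi_subproof (k : nat) (x : Rlen k) :
  inclR x * projR (Q [:: 0%N]) \in spanp (Rlen_gen k.+1).
Proof.
apply: (@spanp_mulr _ (Rlen_gen k)); last exact: (svalP x).
move=> _ [I [sI ->]]; exists (I ++ [:: 0%N]); split; first by rewrite size_cat sI addn1.
by rewrite Q_cat projRM.
Qed.

Definition phi (k : nat) (x : Rlen k) : Rlen k.+1 :=
  exist _ (inclR x * projR (Q [:: 0%N])) (phi_subproof x).

Definition Rlim : lmodType F2 := direct_limit phi.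

Definition comulRlim : Rlim -> tensor Rlim Rlim := limit_comul comulRlen.
Definition counitRlim : Rlim -> F2 := limit_counit counitRlen.

(* On the basis of admissible monomials, Q^I is sent to Q^I Q^0 ... Q^0, with  *)
(* [k - l(I)] factors Q^0.                                                     *)
Definition pi_len (k : nat) (a : A2_le k) : Rlen k :=
  extend (fun I : {fmonom nat} => Rlen_mono k (I ++ nseq (k - size I) 0%N))
    (admissible_expansion a).

(* Main.v *)
Require Import Defs.
From mathcomp Require Import all_boot all_algebra.
From HB Require Import structures.
From mathcomp Require Import finmap zify.
From mathcomp.multinomials Require Import monalg.
Import GRing.Theory.
Local Open Scope ring_scope.

(** The direct limit of the [R[k]] along right multiplication by [Q^0] is
    one-dimensional, and the map of the theorem is the counit of the Steenrod
    algebra followed by the unit of the limit.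

    In the Adem relation for [Q^r Q^0] with [r > 0], every term of non-zero
    coefficient has negative excess except [Q^t Q^t] with [2t = r]
    ([projR_Q_Q0]).  Hence [Q^r Q^0 = 0] for odd [r] and
    [Q^(2t) Q^0 = Q^t Q^t], so that [Q^r] is annihilated by right multiplication
    by [(Q^0)^n] when [0 < r < 2^n] ([projR_Q_zeros]).  A word with a positive
    letter therefore vanishes in the limit, and all the words [(Q^0)^k] have the
    same class [unit_class] there ([to_limit_mono]).  The class of an element of
    [R[k]] is thus its counit times [unit_class] ([to_limitE]).

    As [(Q^0)^k] is group-like, so is [unit_class], and the composite of counit
    and unit is a coalgebra map ([limit_map_coalgebra]).  It agrees with the maps
    [pi_len], which send an admissible word to its product with a power of [Q^0]:
    the empty word goes to [(Q^0)^k] and every other one dies in the limit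
    ([limit_map_stage]).

    What remains is that the structure maps, which are defined by means of
    representatives, take the expected values.  The projections of [R] onto the
    [R[k]] are well defined because the relations are homogeneous for the length
    of words ([projR_kernel], [part_projR]).  Coproducts are compared after mapping
    to the limit, where only the coefficients of the words [Q^0 ... Q^0] in a
    single representative in the free algebra matter ([zero_coef_comul]). *)

Set Implicit Arguments.
Unset Strict Implicit.
Unset Printing Implicit Defensive.

(** * Linear maps out of free modules, tensor products and direct limits *)

HB.instance Definition _ (V V' W W' : lmodType F2) (f : {linear V -> V'})
  (g : {linear W -> W'}) :=
  GRing.isLinear.Build F2 (tensor V W) (tensor V' W') _ (tmap f g)
    (tmap_linear f g).

HB.instance Definition _ (V : nat -> lmodType F2) (f : forall k, V k -> V k.+1) k :=
  GRing.isLinear.Build F2 (V k) (direct_limit f) _ (@to_limit V f k)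
    (@to_limit_linear V f k).

Lemma to_limitZ (V : nat -> lmodType F2) (f : forall k, V k -> V k.+1) k c
  (x : V k) : to_limit f (c *: x) = c *: to_limit f x.
Proof. exact: linearZ. Qed.

Lemma malg_ext (K : choiceType) (W : lmodType F2)
    (f g : {linear {malg F2[K]} -> W}) :
  (forall k, f << k >> = g << k >>) -> f =1 g.
Proof.
move=> fg x; rewrite [x]monalgE !linear_sum; apply: eq_bigr => k _.
have -> : << x@_k *g k >> = x@_k *: << k >> :> {malg F2[K]}.
  by apply/malgP => l; rewrite mcoeffZ !mcoeffU mulrnAr mulr1.
by rewrite !linearZ fg.
Qed.

Lemma F0_ext (W : lmodType F2) (f g : {linear F0 -> W}) :
  (forall I, f (Q I) = g (Q I)) -> f =1 g.
Proof. by move=> fg; apply: malg_ext => -[I]; apply: fg. Qed.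

Lemma tensor_ext (V W X : lmodType F2) (f g : {linear tensor V W -> X}) :
  (forall v w, f (tens v w) = g (tens v w)) -> f =1 g.
Proof.
move=> fg z; rewrite -[z]proj_repr; move: (repr z).
by apply: (malg_ext (f := f \o proj _) (g := g \o proj _)) => -[v w]; apply: fg.
Qed.

Lemma tmap_comp (V V' V'' W W' W'' : lmodType F2)
    (f : {linear V' -> V''}) (f' : {linear V -> V'})
    (g : {linear W' -> W''}) (g' : {linear W -> W'}) z :
  tmap f g (tmap f' g' z) = tmap (f \o f') (g \o g') z.
Proof.
by apply: (tensor_ext (f := tmap f g \o tmap f' g')) => v w /=; rewrite !tmapE.
Qed.

Lemma eq_tmap (V V' : lmodType F2) (f g : {linear V -> V'}) :
  f =1 g -> tmap f f =1 tmap g g.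
Proof. by move=> fg; apply: tensor_ext => v w; rewrite /= !tmapE !fg. Qed.

(** This is the universal property of the direct limit: what is linear on each
    stage and compatible with the transition maps factors through the limit. *)
Lemma limit_rel_extend (V : nat -> lmodType F2) (f : forall k, V k -> V k.+1)
    (W : lmodType F2) (h : {k : nat & V k} -> W) :
    (forall k, linear (fun x : V k => h (Tagged (fun k => V k : Type) x))) ->
    (forall k (x : V k), h (Tagged (fun k => V k : Type) (f k x)) =
       h (Tagged (fun k => V k : Type) x)) ->
  forall s, limit_rel f s -> extend h s = 0.
Proof.
move=> hL hf; have hU k (x : V k) :
    extend h (stage x) = h (Tagged (fun k => V k : Type) x).
  exact: extendU.
move=> s; case=> [k x y|k c x|k x].
- rewrite !linearB /= !hU -{1}[x]scale1r hL scale1r.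
  by rewrite addrAC addrK subrr.
- rewrite addrC -scaleNr extend_linear !hU -[c *: x]addr0 hL scaleNr addKr.
  by have := hL k (-1) 0 0; rewrite scaler0 addr0 scaleN1r addNr.
- by rewrite linearB /= !hU hf subrr.
Qed.

Section TensorMul.
Variables (A : lalgType F2).

Fact left_mul_linear (a : A) : linear ( *%R a).
Proof. by move=> c x y; rewrite mulrDr !F2_scale mulrnAr. Qed.

HB.instance Definition _ (a : A) :=
  GRing.isLinear.Build F2 A A _ ( *%R a) (left_mul_linear a).

Let act (z : tensor A A) (p : A * A) := tmap ( *%R p.1) ( *%R p.2) z.

(** This makes the product of [A (x) A] well defined in its left factor: for a
    fixed [z], the two-sided action of [(a, b)] on [z] is bilinear in [(a, b)]. *)
Lemma act_rel z x : bilinear_rel x -> extend (act z) x = 0.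
Proof.
case=> [v v' w|v w w'|c v w|c v w];
  rewrite !linearB /= ?[extend _ (c *: _)]linearZ /= !extendU /act /=.
- rewrite -addrA -opprD; apply/eqP; rewrite subr_eq0; apply/eqP.
  apply: (tensor_ext (g := tmap ( *%R v) ( *%R w) \+ tmap ( *%R v') ( *%R w))) => a b /=.
  by rewrite !tmapE /= mulrDl tensDl.
- rewrite -addrA -opprD; apply/eqP; rewrite subr_eq0; apply/eqP.
  apply: (tensor_ext (g := tmap ( *%R v) ( *%R w) \+ tmap ( *%R v) ( *%R w'))) => a b /=.
  by rewrite !tmapE /= mulrDl tensDr.
- apply/eqP; rewrite subr_eq0; apply/eqP.
  apply: (tensor_ext (g := c \*: tmap ( *%R v) ( *%R w))) => a b /=.
  by rewrite !tmapE /= -scalerAl tensZl.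
- apply/eqP; rewrite subr_eq0; apply/eqP.
  apply: (tensor_ext (g := c \*: tmap ( *%R v) ( *%R w))) => a b /=.
  by rewrite !tmapE /= -scalerAl tensZr.
Qed.

Lemma tensor_mul_sum (I : Type) (r : seq I) (a b : I -> A) z :
  tensor_mul (\sum_(i <- r) tens (a i) (b i)) z =
  \sum_(i <- r) tmap ( *%R (a i)) ( *%R (b i)) z.
Proof.
rewrite -linear_sum /tensor_mul (inducedE (act_rel z)) linear_sum.
by apply: eq_bigr => i _; rewrite /= extendU.
Qed.
End TensorMul.

(** * The coproduct of the free Hopf algebra *)

Lemma comulF0_Qcons i I :
  comulF0 (Q (i :: I)) = \sum_(0 <= t < i.+1)
    tmap ( *%R (Q [:: (i - t)%N])) ( *%R (Q [:: t])) (comulF0 (Q I)).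
Proof.
rewrite /comulF0 [LHS]extendU.
have -> : extend (fun I : {fmonom nat} => foldr
      (fun i z => tensor_mul (comul_generator i) z) (tens 1 1) (I : seq nat)) (Q I)
    = foldr (fun i z => tensor_mul (comul_generator i) z) (tens 1 1) I.
  by rewrite [LHS]extendU.
exact: tensor_mul_sum.
Qed.

(** Stated for an arbitrary algebra, where multiplication by [a (x) b] is the
    tensor product of two linear maps: functionals that turn multiplication by
    [a] and [b] into scalars can then be pulled through the coproduct. *)
Lemma tmap_mul (A : lalgType F2) (X X' : lmodType F2)
    (f f' : {linear A -> X}) (g g' : {linear A -> X'}) (a b : A) (c d : F2) z :
    (forall x, f (a * x) = c *: f' x) -> (forall x, g (b * x) = d *: g' x) ->
  tmap f g (tmap ( *%R a) ( *%R b) z) = (c * d) *: tmap f' g' z.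
Proof.
move=> fa gb; rewrite tmap_comp.
apply: (tensor_ext (g := (c * d) \*: tmap f' g')) => v w /=.
by rewrite !tmapE /= fa gb tensZl tensZr scalerA.
Qed.

(** A linear map that kills every word starting with a positive letter only sees
    the term [Q^0 (x) Q^0] of the coproducts of the generators, and this term
    occurs in the coproduct of [Q^0] alone. *)
Lemma comulF0_cons (W : lmodType F2) (f f' : {linear F0 -> W}) i I :
    (forall j J, f (Q (j :: J)) = (j == 0%N)%:R *: f' (Q J)) ->
  tmap f f (comulF0 (Q (i :: I))) = (i == 0%N)%:R *: tmap f' f' (comulF0 (Q I)).
Proof.
move=> ff'.
have fQ m x : f (Q [:: m] * x) = (m == 0%N)%:R *: f' x.
  apply: (F0_ext (f := f \o *%R (Q [:: m])) (g := (m == 0%N)%:R \*: f')) => J /=.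
  by rewrite -Q_cat ff'.
rewrite comulF0_Qcons linear_sum; move: (comulF0 _) => z.
rewrite (eq_bigr _ (fun t _ => tmap_mul z (fQ _) (fQ t))).
case: i {I} => [|i]; first by rewrite big_nat1 mulr1.
rewrite big_nat big1 ?scale0r // => t; rewrite ltnS => /andP[_ ti].
by case: t ti => [|t] ti; rewrite ?mulr0 ?subn0 ?mul0r scale0r.
Qed.

(** The counit is the indicator function of the words [Q^0 ... Q^0].  Restricting
    their lengths to a set [S] gives at once the counit ([S] everything) and its
    component of length [k] ([S] a singleton), which is what the stages of the
    limit see. *)
Section ZeroWords.
Variables (S : pred nat) (W : lmodType F2) (g : W).

Definition zero_word (I : seq nat) : bool := all (pred1 0%N) I && S (size I).

Definition zero_coef : F0 -> W :=
  extend (fun I : {fmonom nat} => (zero_word I)%:R *: g).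

HB.instance Definition _ := GRing.isLinear.Build F2 F0 W _ zero_coef
  (extend_linear _).

Lemma zero_coefQ I : zero_coef (Q I) = (zero_word I)%:R *: g.
Proof. exact: extendU. Qed.
End ZeroWords.

Lemma zero_coefE S (W : lmodType F2) (g : W) y :
  zero_coef S g y = (zero_coef S (1 : F2^o) y : F2) *: g.
Proof.
rewrite /zero_coef /extend scaler_suml; apply: eq_bigr => I _.
by rewrite scalerA /GRing.scale /= mulr1.
Qed.

HB.instance Definition _ := GRing.isLinear.Build F2 F0 F2^o _
  (counitF0 : F0 -> F2^o) (extend_linear _).

Lemma counitF0E y : counitF0 y = zero_coef predT (1 : F2^o) y.
Proof.
apply: (F0_ext (f := counitF0)) => I.
by rewrite /= zero_coefQ counitF0_Q /zero_word andbT -[RHS]/(_ * _) mulr1.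
Qed.

HB.instance Definition _ := GRing.isLinear.Build F2 F0 (tensor F0 F0) _ comulF0
  (extend_linear _).

(** Every word [Q^0 ... Q^0] is group-like and has only terms of its own length in
    its coproduct.  Removing the first letter shifts the set of lengths, so the
    induction is over all sets [S] simultaneously. *)
Lemma zero_coef_comul (S : pred nat) (W : lmodType F2) (g : W) y :
  tmap (zero_coef S g) (zero_coef S g) (comulF0 y) = zero_coef S (tens g g) y.
Proof.
apply: (F0_ext (f := tmap (zero_coef S g) (zero_coef S g) \o comulF0)) => I.
rewrite /= zero_coefQ; elim: I S => [|i I IHI] S.
  have -> : comulF0 (Q [::]) = tens (Q [::]) (Q [::]).
    by rewrite [LHS]extendU /= Q_nil.
  by rewrite tmapE /= !zero_coefQ tensZl tensZr scalerA -natrM mulnb andbb.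
rewrite (comulF0_cons (f' := zero_coef (S \o succn) g)) => [|j J].
  by rewrite IHI scalerA -natrM mulnb andbA.
by rewrite /= !zero_coefQ scalerA -natrM mulnb andbA.
Qed.

(** * The length grading of the Dyer-Lashof algebra *)

Fact inclR_linear k : linear (@inclR k).
Proof. by []. Qed.

HB.instance Definition _ k := GRing.isLinear.Build F2 (Rlen k) R _ (@inclR k)
  (@inclR_linear k).

Lemma inclR_inj k : injective (@inclR k).
Proof. exact: val_inj. Qed.

Lemma inclR_mono k I :
  inclR (Rlen_mono k I) = if size I == k then projR (Q I) else 0.
Proof.
rewrite /Rlen_mono; case: insubP => [J -> <- //|/negbTE ->].
exact: (linear0 (@inclR k)).
Qed.

Definition homogeneous (n : nat) : F0 -> Prop :=
  Defs.span (fun x => exists I, size I = n /\ x = Q I).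

Lemma homogeneousQ I : homogeneous (size I) (Q I).
Proof. by apply/spanP/mem_span; exists I. Qed.

Lemma homogeneous_mul n J K x :
  homogeneous n x -> homogeneous (size J + n + size K) (Q J * x * Q K).
Proof.
elim=> [|c _ y [I [<- ->]] _ IH]; first by rewrite mulr0 mul0r; left.
have -> : Q J * (c *: Q I + y) * Q K = c *: Q (J ++ I ++ K) + Q J * y * Q K.
  by rewrite mulrDr mulrDl !Q_cat !F2_scale mulrnAr mulrnAl !mulrA.
by right; first by exists (J ++ I ++ K); rewrite !size_cat addnA.
Qed.

Definition component k : F0 -> Rlen k :=
  extend (fun I : {fmonom nat} => Rlen_mono k I).

HB.instance Definition _ k := GRing.isLinear.Build F2 F0 (Rlen k) _
  (@component k) (extend_linear _).

Lemma componentQ k I : component k (Q I) = Rlen_mono k I.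
Proof. exact: extendU. Qed.

Lemma component_homogeneous k n x : homogeneous n x ->
  inclR (component k x) = if n == k then projR x else 0.
Proof.
elim=> [|c _ y [I [sI ->]] _ IH]; first by rewrite !linear0 if_same.
rewrite linearP [LHS]linearP /= IH componentQ inclR_mono sI.
case: (n == k); first exact: esym (linearP projR c (Q I) y).
by rewrite scaler0 addr0.
Qed.

(** The excess relations and the lifts to the free algebra of the Adem relations
    both belong to this set; it is large enough to generate the kernel of [projR]
    and is stable under taking components of given length. *)
Definition homogeneous_rel (x : F0) : Prop :=
  exists n, homogeneous n x /\ projR x = 0.

Definition right_mul (A : lalgType F2) (b x : A) : A := x * b.

Fact right_mul_linear (A : lalgType F2) (b : A) : linear (right_mul b).
Proof. by move=> c x y; rewrite /right_mul mulrDl scalerAl. Qed.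

HB.instance Definition _ (A : lalgType F2) (b : A) :=
  GRing.isLinear.Build F2 A A _ (right_mul b) (right_mul_linear b).

(** A product [Q^J s Q^K] with [s] homogeneous is itself homogeneous, so each of its
    components is either zero or the whole product, which is zero in [R]. *)
Lemma component_ideal k x :
  x \in spanp (two_sided homogeneous_rel) -> component k x = 0.
Proof.
move=> /spanP; elim=> [|c _ y [a [s [b [[n [hs s0]] ->]]]] _ IH].
  exact: linear0.
rewrite linearP /= IH addr0 {y IH}.
suff -> : component k (a * s * b) = 0 by rewrite scaler0.
move: a; apply: (F0_ext (f := @component k \o right_mul b \o right_mul s) (g := \0)) => J.
move: b; apply: (F0_ext (f := @component k \o *%R (Q J * s)) (g := \0)) => K.
apply: inclR_inj; rewrite [RHS]linear0 /=.
rewrite (component_homogeneous _ (homogeneous_mul J K hs)).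
by rewrite !projRM s0 mulr0 mul0r if_same.
Qed.

Lemma projU_surj (a : U) : exists x, a = projU x.
Proof. by exists (repr a); rewrite [RHS]aproj_repr. Qed.

Lemma projR_adem r s : (2 * s < r)%N ->
  projR (Q [:: r; s]) = \sum_(1 <= t < (r + s).+1 | (r <= 2 * t)%N)
    ('C(t - s - 1, 2 * t - r))%:R *: projR (Q [:: (r + s - t)%N; t]).
Proof.
move=> rs.
have /eqP : projUR (dyer_lashof r s) = 0.
  rewrite -[RHS](linear0 projUR); apply/projP/mem_span; rewrite subr0.
  by exists 1, (dyer_lashof r s), 1; rewrite mul1r mulr1; split=> //; exists r, s.
by rewrite /dyer_lashof (linear_subr_sum projUR) subr_eq0 => /eqP.
Qed.

Lemma projR_excess I : negative_excess I -> projR (Q I) = 0.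
Proof.
move=> eI; suff QI0 : projU (Q I) = 0 by rewrite projRE QI0 [LHS]linear0.
rewrite -[RHS](linear0 projU); apply/projP/mem_span; rewrite subr0.
by exists 1, (Q I), 1; rewrite mul1r mulr1; split=> //; exists I.
Qed.

Lemma homogeneous_combination n (r : seq nat) (P : pred nat) (c : nat -> F2)
    (I : nat -> seq nat) :
  (forall t, size (I t) = n) ->
  homogeneous n (\sum_(t <- r | P t) c t *: Q (I t)).
Proof.
move=> sI; apply/spanP; apply: rpred_sum => t _; apply/rpredZ/mem_span.
by exists (I t).
Qed.

(** [R] is a quotient of a quotient of the free algebra: an element of the kernel
    is first corrected, by lifting Adem relations, to an element which vanishes
    already in [U], and the latter is a combination of multiples of words of
    negative excess. *)
Lemma projR_kernel y :
  projR y = 0 -> y \in spanp (two_sided homogeneous_rel).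
Proof.
move=> y0.
have /projP : projUR (projU y) = projUR 0 by rewrite [RHS]linear0.
rewrite subr0 => yS.
have [z zH yz] : exists2 z, z \in spanp (two_sided homogeneous_rel)
    & projU y = projU z.
  move/spanP: yS; elim=> [|c _ x [a [_ [b [[r [s [rs ->]]] ->]]]] _ [z zH ->]].
    by exists 0; rewrite ?rpred0 ?[RHS]linear0.
  have [[a' ->] [b' ->]] := (projU_surj a, projU_surj b).
  set d := Q [:: r; s] - \sum_(1 <= t < (r + s).+1 | (r <= 2 * t)%N)
    ('C(t - s - 1, 2 * t - r))%:R *: Q [:: (r + s - t)%N; t].
  have dE : projU d = dyer_lashof r s by rewrite linear_subr_sum.
  exists (c *: (a' * d * b') + z); last first.
    by rewrite [RHS]linearP !projUM dE.
  rewrite rpredD // rpredZ // mem_span //; exists a', d, b'; split=> //; exists 2.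
  split; last by rewrite linear_subr_sum -projR_adem ?subrr.
  apply/spanP/rpredB; first exact/spanP/(homogeneousQ [:: r; s]).
  exact/spanP/homogeneous_combination.
rewrite -[y](subrK z) rpredD //.
move/projP: yz => /spanP; elim=> [|c _ x [a [_ [b [[I [eI ->]] ->]]]] _ IH].
  exact: rpred0.
rewrite rpredD // rpredZ // mem_span //; exists a, (Q I), b; split=> //.
by exists (size I); split; [exact: homogeneousQ | exact: projR_excess].
Qed.

(** [part] is defined through an arbitrary representative in the free algebra; the
    homogeneity of the relations makes the choice irrelevant. *)
Lemma part_projR k y : part k (projR y) = component k y.
Proof.
rewrite /part -/(component k _); set y' : F0 := repr _.
have yy' : projR y' = projR y.
  by rewrite projRE [projU y']aproj_repr [LHS]aproj_repr.
apply/eqP; rewrite -subr_eq0 -linearB; apply/eqP.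
apply/component_ideal/projR_kernel; apply/eqP.
by rewrite linearB subr_eq0; apply/eqP.
Qed.

Lemma projR_surj (x : R) : exists y, x = projR y.
Proof.
by exists (repr (repr x : U)); rewrite projRE [projU _]aproj_repr [RHS]aproj_repr.
Qed.

Fact part_linear k : linear (@part k).
Proof.
move=> c x y; have [[x' ->] [y' ->]] := (projR_surj x, projR_surj y).
by rewrite -[c *: _ + _](linearP projR) !part_projR linearP.
Qed.

HB.instance Definition _ k := GRing.isLinear.Build F2 R (Rlen k) _ (@part k)
  (@part_linear k).

Lemma part_inclR k : cancel (@inclR k) (@part k).
Proof.
move=> x; apply: inclR_inj.
elim: (spanP _ _ (svalP x) : Defs.span _ (inclR x)) => [|c _ y [I [sI ->]] _ IH].
  by rewrite linear0 [LHS]linear0.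
by rewrite linearP [LHS]linearP /= IH part_projR componentQ inclR_mono sI eqxx.
Qed.

(** * The collapse of the direct limit *)

(** In the Adem relation for [Q^r Q^0], the binomial coefficients force [r <= 2t],
    while [Q^(r-t) Q^t] has negative excess as soon as [r < 2t].  Only [2t = r]
    remains, with coefficient 1. *)
Lemma projR_Q_Q0 r : (0 < r)%N ->
  projR (Q [:: r; 0%N]) = if odd r then 0 else projR (Q [:: r./2; r./2]).
Proof.
move=> r_gt0; rewrite projR_adem ?muln0 // addn0.
have kill t : (r < 2 * t)%N -> projR (Q [:: (r - t)%N; t]) = 0.
  move=> rt; apply: projR_excess; rewrite /= /excess /= addn0.
  by rewrite Num.Theory.subr_lt0 ltz_nat; lia.
case: ifP => r_odd.
  rewrite big_nat_cond big1 // => t /andP[_ rt].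
  by rewrite kill ?scaler0 //; lia.
have r2 : (2 * r./2 = r)%N by lia.
rewrite big_mkcond (bigD1_seq r./2) ?iota_uniq ?mem_index_iota //; last by lia.
rewrite big1 => [|t tr]; last by case: ifP => // rt; rewrite kill ?scaler0 //; lia.
rewrite r2 leqnn subnn bin0 scale1r [LHS]addr0.
by have -> : (r - r./2 = r./2)%N by lia.
Qed.

(** Each factor [Q^0] halves [r]: [Q^(2t) Q^0 = Q^t Q^t], after which the induction
    applies to the right-hand [Q^t]; sooner or later an odd number appears, for
    which the product vanishes. *)
Lemma projR_Q_zeros r n : (0 < r < 2 ^ n)%N -> projR (Q (r :: nseq n 0%N)) = 0.
Proof.
elim: n r => [|n IHn] r; first by case: r => [|[]].
rewrite expnS => rn; rewrite -[_ :: _]/([:: r; 0%N] ++ nseq n 0%N) Q_cat projRM.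
rewrite projR_Q_Q0; last by lia.
case: ifP => r_odd; first by rewrite mul0r.
rewrite -projRM -Q_cat -[_ ++ _]/([:: r./2] ++ (r./2 :: nseq n 0%N)) Q_cat projRM.
by rewrite IHn ?mulr0 //; lia.
Qed.

(** The last positive letter of the word is annihilated by sufficiently many
    factors [Q^0] on its right. *)
Lemma projR_nonzero_word I :
  ~~ all (pred1 0%N) I -> exists n, projR (Q (I ++ nseq n 0%N)) = 0.
Proof.
elim: I => [//|i I IHI]; rewrite [all _ _]/=.
case: (boolP (all (pred1 0%N) I)) => [/all_pred1P -> | /IHI].
  rewrite andbT => i0; exists i; rewrite cat_cons -nseqD; apply: projR_Q_zeros.
  by rewrite lt0n i0 (leq_trans (ltn_expl i (ltnSn 1))) // leq_exp2l // leq_addl.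
case=> n In _; exists n.
by rewrite cat_cons -cat1s Q_cat projRM In mulr0.
Qed.

Lemma inclR_phi k (x : Rlen k) : inclR (phi x) = inclR x * projR (Q [:: 0%N]).
Proof. by []. Qed.

Lemma Rlen_mono_phi k n I : size I = k ->
  to_limit phi (Rlen_mono (k + n) (I ++ nseq n 0%N)) = to_limit phi (Rlen_mono k I).
Proof.
move=> sI; elim: n => [|n IHn]; first by rewrite addn0 cats0.
rewrite -IHn addnS -[RHS]to_limit_step; congr to_limit; apply: inclR_inj.
have -> : nseq n.+1 0%N = nseq n 0%N ++ [:: 0%N] by rewrite -addn1 nseqD.
rewrite inclR_phi !inclR_mono catA !size_cat !size_nseq sI addn1 !eqxx.
by rewrite Q_cat projRM.
Qed.

(** All the words [Q^0 ... Q^0] have this class, the transition maps sending each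
    of them to the next. *)
Definition unit_class : Rlim := to_limit phi (Rlen_mono 0 [::]).

Lemma to_limit_mono k I : size I = k ->
  to_limit phi (Rlen_mono k I) = (all (pred1 0%N) I)%:R *: unit_class.
Proof.
move=> sI; case: allP => [/allP/all_pred1P I0|/allP/projR_nonzero_word[n I0]].
  rewrite scale1r I0 sI; exact: (@Rlen_mono_phi 0 k [::] erefl).
rewrite scale0r -(Rlen_mono_phi n sI).
suff -> : Rlen_mono (k + n) (I ++ nseq n 0%N) = 0 by exact: linear0.
by apply: inclR_inj; rewrite inclR_mono I0 if_same [RHS]linear0.
Qed.

Lemma to_limit_component k y :
  to_limit phi (component k y) = zero_coef (pred1 k) unit_class y.
Proof.
apply: (F0_ext (f := @to_limit _ phi k \o @component k)) => I /=.
rewrite componentQ zero_coefQ /zero_word /=; case: eqP => [/to_limit_mono ->|/eqP sI].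
  by rewrite andbT.
rewrite andbF scale0r; suff -> : Rlen_mono k I = 0 by exact: linear0.
by apply: inclR_inj; rewrite inclR_mono (negbTE sI) [RHS]linear0.
Qed.

Lemma counitR_projR y : counitR (projR y) = counitF0 y.
Proof.
rewrite -counitU_projU projRE.
exact: (augmentation_induced counitU_augmentation counitU_dyer_lashof
  dyer_lashof_proper).2.
Qed.

Lemma counitF0_linear c x y : counitF0 (c *: x + y) = c * counitF0 x + counitF0 y.
Proof. exact: (linearP counitF0). Qed.

Lemma counitR_linear c x y : counitR (c *: x + y) = c * counitR x + counitR y.
Proof.
have [[x' ->] [y' ->]] := (projR_surj x, projR_surj y).
by rewrite -[_ + _](linearP projR) !counitR_projR counitF0_linear.
Qed.

Fact counitRlen_linear k : linear (@counitRlen k : Rlen k -> F2^o).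
Proof. by move=> c x y; rewrite /counitRlen linearP counitR_linear. Qed.

HB.instance Definition _ k := GRing.isLinear.Build F2 (Rlen k) F2^o _
  (@counitRlen k) (@counitRlen_linear k).

Lemma counitRlen_component k y :
  counitRlen (component k y) = zero_coef (pred1 k) (1 : F2^o) y.
Proof.
apply: (@F0_ext F2^o (@counitRlen k \o @component k)
  (zero_coef (pred1 k) (1 : F2^o)) _ y) => I /=.
rewrite componentQ zero_coefQ /counitRlen inclR_mono /zero_word /=.
case: eqP => _; first by rewrite counitR_projR counitF0_Q andbT -[RHS]/(_ * _) mulr1.
by rewrite andbF scale0r -[0](linear0 projR) counitR_projR /counitF0 linear0.
Qed.

(** The very representative through which the coproduct and the counit of [R] are
    defined, so that both can be computed on it. *)
Definition word_expansion k (x : Rlen k) : F0 := repr (repr (inclR x) : U).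

Lemma component_expansion k (x : Rlen k) : component k (word_expansion x) = x.
Proof. exact: part_inclR. Qed.

(** The limit is one-dimensional: a class is determined by its counit. *)
Lemma to_limitE k (x : Rlen k) : to_limit phi x = counitRlen x *: unit_class.
Proof.
rewrite -{1 2}(component_expansion x) to_limit_component counitRlen_component.
exact: zero_coefE.
Qed.

(** The coproduct of [R[k]] is computed from one representative in the free algebra,
    on which the composite with the map to the limit is the coefficient of the
    group-like word [(Q^0)^k]. *)
Lemma comulRlen_limit k (x : Rlen k) :
  tmap (@to_limit _ phi k) (@to_limit _ phi k) (comulRlen x) =
  counitRlen x *: tens unit_class unit_class.
Proof.
rewrite /comulRlen /comulR /quotient_comul /comulU /quotient_comul -/(word_expansion x).
rewrite !tmap_comp.
rewrite (eq_tmap (g := zero_coef (pred1 k) unit_class)); last first.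
  move=> y /=; rewrite -[aproj _ _]/(projR y) part_projR; exact: to_limit_component.
rewrite zero_coef_comul -{2}(component_expansion x) counitRlen_component.
exact: zero_coefE.
Qed.

Lemma counitRlen_phi k (x : Rlen k) : counitRlen (phi x) = counitRlen x.
Proof.
rewrite /counitRlen inclR_phi; have [y ->] := projR_surj (inclR x).
rewrite -projRM !counitR_projR; case: counitF0_augmentation => _ -> _.
by rewrite counitF0_Q mulr1.
Qed.

(** By the preceding computations, both the coproduct and the counit of the limit
    are given on stages by a multiple of the counit; this makes them well defined. *)
Lemma limit_rel_counit (W : lmodType F2) (w : W) (h : {k : nat & Rlen k} -> W) :
    (forall p, h p = counitRlen (tagged p) *: w) ->
  forall s, limit_rel phi s -> extend h s = 0.
Proof.
move=> hE; apply: limit_rel_extend => [k c x y|k x].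
  by rewrite !hE /= [counitRlen _](linearP (@counitRlen k)) scalerDl scalerA.
by rewrite !hE /= counitRlen_phi.
Qed.

Lemma comulRlim_to_limit k (x : Rlen k) :
  comulRlim (to_limit phi x) = counitRlen x *: tens unit_class unit_class.
Proof.
rewrite /comulRlim /limit_comul inducedE; first by rewrite [LHS]extendU comulRlen_limit.
by apply: limit_rel_counit => -[l z]; apply: comulRlen_limit.
Qed.

Lemma counitRlim_to_limit k (x : Rlen k) :
  counitRlim (to_limit phi x) = counitRlen x.
Proof.
pose h (p : {k : nat & Rlen k}) : F2^o := counitRlen (tagged p).
rewrite -[LHS]/(induced (extend h) (to_limit phi x)) inducedE.
  exact: (extendU h (Tagged (fun k => Rlen k : Type) x)).
by apply: (limit_rel_counit (w := (1 : F2^o))) => -[l z]; rewrite -[RHS]/(_ * _) mulr1.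
Qed.

(** * The map from the Steenrod algebra to the limit *)

Lemma counitA_projA y : counitA (projA y) = counitF0 y.
Proof.
exact: (augmentation_induced counitF0_augmentation counitF0_steenrod
  steenrod_proper).2.
Qed.

(** The composite of the counit of [A2] with the unit of the one-dimensional
    limit. *)
Definition limit_map (a : A2) : Rlim := counitA a *: unit_class.

Fact limit_map_linear : linear limit_map.
Proof.
move=> c a b; have [x ->] : exists x, a = projA x.
  by exists (repr a); rewrite [RHS]aproj_repr.
have [y ->] : exists y, b = projA y by exists (repr b); rewrite [RHS]aproj_repr.
by rewrite /limit_map -linearP !counitA_projA counitF0_linear scalerDl scalerA.
Qed.

HB.instance Definition _ :=
  GRing.isLinear.Build F2 A2 Rlim _ limit_map limit_map_linear.

Lemma limit_map_coalgebra :
  coalgebra_map comulA counitA comulRlim counitRlim limit_map.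
Proof.
have mono1 : counitRlen (Rlen_mono 0 [::]) = 1.
  by rewrite /counitRlen inclR_mono /= counitR_projR counitF0_Q.
have limit_mapE a : limit_map a = to_limit phi (counitA a *: Rlen_mono 0 [::]).
  by rewrite linearZ.
have scaled a : counitRlen (counitA a *: Rlen_mono 0 [::]) = counitA a.
  by rewrite linearZ /= mono1 -[LHS]/(_ * _) mulr1.
split=> a; last by rewrite /= limit_mapE counitRlim_to_limit scaled.
rewrite /= limit_mapE comulRlim_to_limit scaled /comulA /quotient_comul tmap_comp.
rewrite (eq_tmap (g := zero_coef predT unit_class)); last first.
  by move=> y; rewrite /= /limit_map counitA_projA counitF0E -zero_coefE.
by rewrite zero_coef_comul zero_coefE -counitF0E.
Qed.

(** A non-empty admissible word has a positive letter, hence vanishes in the limit,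
    as it does under the counit; the empty word goes to [(Q^0)^k], of counit 1.
    Thus the value computed from any expansion of [a] into words of length at most
    [k] depends only on the counit of [a]. *)
Lemma limit_map_stage k (a : A2_le k) :
  limit_map (inclA a) = to_limit phi (pi_len a).
Proof.
case: (admissible_expansionP a); rewrite /pi_len; move: (admissible_expansion a) => x.
move=> <- xI; rewrite /limit_map counitA_projA counitF0E -zero_coefE.
rewrite /zero_coef /extend linear_sum; apply: eq_big_seq => I /xI /andP[_ sI] /=.
have sIk : size ((I : seq nat) ++ nseq (k - size I) 0%N) = k.
  by rewrite size_cat size_nseq subnKC.
rewrite (@to_limitZ Rlen phi) (to_limit_mono sIk).
by rewrite /zero_word andbT all_cat all_nseq /= orbT andbT.
Qed.

Theorem corollary6 :
  exists pi : {linear A2 -> Rlim},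
    coalgebra_map comulA counitA comulRlim counitRlim pi /\
    (forall (k : nat) (a : A2_le k), (1 <= k)%N ->
       pi (inclA a) = to_limit phi (pi_len a)).
Proof.
exists limit_map; split; first exact: limit_map_coalgebra.
by move=> k a _; apply: limit_map_stage.
Qed.
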